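(* Let $\delta\in\{0,1\}$ and $$A=\begin{pmatrix}1 & 0 & \delta\\ 0 & 0 & -1\\ 0 & 1 & -1\end{pmatrix}\in\mathrm{GL}_3(\mathbb{Z}).$$ Then the group $\mathbb{Z}^3\rtimes_A\mathbb{Z}$ has Reidemeister spectrum $6\mathbb{N}\cup\{\infty\}$.
   Context: $\mathbb{N}$ denotes the set of positive integers. For $A\in\mathrm{GL}_n(\mathbb{Z})$, $\mathbb{Z}^n\rtimes_A\mathbb{Z}$ denotes the semidirect product in which a generator of $\mathbb{Z}$ acts on $\mathbb{Z}^n$ by multiplication by $A$. For a group $G$ and an endomorphism $\varphi$ of $G$, say $x\sim_\varphi y$ if there is $z\in G$ with $x=zy\varphi(z)^{-1}$; the Reidemeister number $R(\varphi)$ is the number of equivalence classes of $\sim_\varphi$ ($\infty$ if infinite). The Reidemeister spectrum of $G$ is $\mathrm{Spec}_R(G)=\{R(\varphi)\mid \varphi\in\mathrm{Aut}(G)\}$. *)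

(* Defs.v *)
From HB Require Import structures.
From mathcomp Require Import all_boot all_order all_algebra.
From mathcomp Require Import finmap.
From mathcomp Require Import boolp classical_sets cardinality constructive_ereal.

Set Implicit Arguments.
Unset Strict Implicit.
Unset Printing Implicit Defensive.

Import GRing.Theory.

Local Open Scope classical_set_scope.
Local Open Scope group_scope.

Definition twisted_conj (G : groupType) (phi : {multiplicative G -> G})
    (x y : G) : Prop :=
  exists z : G, x = z * y * (phi z)^-1.

Definition twisted_class (G : groupType) (phi : {multiplicative G -> G})
    (y : G) : set G :=
  [set x | twisted_conj phi x y].

Definition twisted_classes (G : groupType) (phi : {multiplicative G -> G}) :
    set (set G) :=
  range (twisted_class phi).

(* The number of classes, as an extended natural number; -oo is never used. *)
Definition reidemeister_number (G : groupType)
    (phi : {multiplicative G -> G}) : \bar nat :=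
  if `[< finite_set (twisted_classes phi) >]
  then EFin #|` fset_set (twisted_classes phi)|%fset else +oo%E.

Definition reidemeister_spectrum (G : groupType) : set (\bar nat) :=
  [set reidemeister_number phi
     | phi in [set phi : {multiplicative G -> G} | bijective phi]].

Local Open Scope ring_scope.

(* The carrier of Z^m x|_A Z with m = n.+1: the pair (v, k) stands for v t^k,
   where the generator t of Z satisfies t v t^-1 = A v. *)
Definition sdprodZ (n : nat) (A : 'M[int]_n.+1) (uA : A \in unitmx) : Type :=
  ('cV[int]_n.+1 * int)%type.

Section SdprodZ.
Variables (n : nat) (A : 'M[int]_n.+1) (uA : A \in unitmx).

HB.instance Definition _ := Choice.copy (sdprodZ uA) ('cV[int]_n.+1 * int)%type.

Definition sdprodZ_one : sdprodZ uA := (0, 0).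

Definition sdprodZ_mul (x y : sdprodZ uA) : sdprodZ uA :=
  (x.1 + A ^ x.2 *m y.1, x.2 + y.2).

Definition sdprodZ_inv (x : sdprodZ uA) : sdprodZ uA :=
  (- (A ^ (- x.2) *m x.1), - x.2).

Lemma sdprodZ_mulA : associative sdprodZ_mul.
Proof.
move=> x y z; rewrite /sdprodZ_mul /=; congr pair; last by rewrite addrA.
by rewrite mulmxDr mulmxA addrA exprzDr.
Qed.

Lemma sdprodZ_mul1 : left_id sdprodZ_one sdprodZ_mul.
Proof. by case=> v k; rewrite /sdprodZ_mul /= mul1mx !add0r. Qed.

Lemma sdprodZ_mulr1 : right_id sdprodZ_one sdprodZ_mul.
Proof. by case=> v k; rewrite /sdprodZ_mul /= mulmx0 !addr0. Qed.

Lemma sdprodZ_mulV : left_inverse sdprodZ_one sdprodZ_inv sdprodZ_mul.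
Proof. by case=> v k; rewrite /sdprodZ_mul /= !addNr. Qed.

Lemma sdprodZ_mulrV : right_inverse sdprodZ_one sdprodZ_inv sdprodZ_mul.
Proof.
case=> v k; rewrite /sdprodZ_mul /= mulmxN mulmxA.
have -> : A ^ k *m A ^ (- k) = A ^ (k - k) by rewrite exprzDr.
by rewrite subrr mul1mx subrr.
Qed.

HB.instance Definition _ := isGroup.Build (sdprodZ uA)
  sdprodZ_mulA sdprodZ_mul1 sdprodZ_mulr1 sdprodZ_mulV sdprodZ_mulrV.

End SdprodZ.

Definition matA (delta : int) : 'M[int]_3 :=
  \matrix_(i < 3, j < 3)
    nth 0 (nth [::] [:: [:: 1; 0; delta];
                        [:: 0; 0;    -1];
                        [:: 0; 1;    -1]] i) j.

Lemma matA_unit (delta : int) : matA delta \in unitmx.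
Proof.
rewrite unitmxE.
suff -> : \det (matA delta) = 1 by rewrite unitr1.
rewrite (expand_det_row _ ord0) !big_ord_recl big_ord0 !mxE /= mul0r mul1r.
rewrite /cofactor !(expand_det_row _ ord0) !big_ord_recl !big_ord0 /cofactor.
rewrite !det_mx11 !mxE /=.
by rewrite !(mul0r, mul1r, addr0, add0r, expr0, mulN1r, mulr1, mulr0).
Qed.

(* Main.v *)
(* Let P be the rank 2 plane on which A acts with minimal polynomial 1 + X + X^2;
   it is the isolator of the commutator subgroup of G, hence characteristic, and
   G/P = Z^2. An automorphism phi induces D on G/P and an automorphism of P = Z[w]
   that is linear or semilinear over conjugation. If R(phi) is finite, then 1 - D
   is injective and so is 1 - A^k phi|P for each k. A semilinear phi|P has
   determinant -1 and trace 0, hence eigenvalue 1; a linear one is a unit of Z[w],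
   and the powers of w are excluded. So phi|P = -A^i, and D preserves the exponent
   of t modulo 3. Over a class of G/P modulo the image of 1 - D, with exponent k,
   there are |det(1 + A^(k+i))| twisted classes: 4 if k + i = 0 modulo 3, and 1
   otherwise. The three residues of k are equally frequent, so R(phi) = 6c with c
   the number of classes of exponent -i modulo 3. *)

Require Import Defs.
From HB Require Import structures.
From mathcomp Require Import all_boot all_order all_algebra.
From mathcomp Require Import finmap zify ring.
From mathcomp Require Import boolp classical_sets cardinality.
From mathcomp Require Import constructive_ereal.

Set Implicit Arguments.
Unset Strict Implicit.
Unset Printing Implicit Defensive.

Import GRing.Theory.

Local Open Scope classical_set_scope.
Local Open Scope ring_scope.

(** * Twisted conjugacy in an arbitrary group *)

Lemma finite_range_collision (T : Type) (f : nat -> T) :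
  finite_set (range f) -> exists i j, (i < j)%N /\ f i = f j.
Proof.
move=> finf; apply: contrapT => noc.
apply: infinite_nat.
have injf : {in [set: nat] &, injective f}.
  move=> i j _ _ fij; apply: contrapT => /eqP; rewrite neq_ltn => /orP[] ij.
    by apply: noc; exists i, j.
  by apply: noc; exists j, i.
by rewrite -(eq_finite_set (inj_card_eq injf)).
Qed.

Section TwistedConjugacy.
Variables (G : groupType) (phi : {multiplicative G -> G}).

Lemma multiplicative1 : phi 1%g = 1%g.
Proof. by apply: (mulgI (phi 1%g)); rewrite -gmulfM !mulg1. Qed.

Lemma multiplicativeV (x : G) : phi (x^-1)%g = ((phi x)^-1)%g.
Proof. by apply/esym/mulg1_eq; rewrite -gmulfM mulgV multiplicative1. Qed.

Lemma twisted_conjP (x y : G) :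
  twisted_conj phi x y <-> exists z, (x * phi z = z * y)%g.
Proof.
split=> -[z e]; exists z; first by rewrite e mulgVK.
by rewrite -e mulgK.
Qed.

Lemma twisted_conj_refl (x : G) : twisted_conj phi x x.
Proof. by apply/twisted_conjP; exists 1%g; rewrite multiplicative1 mulg1 mul1g. Qed.

Lemma twisted_conj_sym (x y : G) : twisted_conj phi x y -> twisted_conj phi y x.
Proof.
move/twisted_conjP=> [z e]; apply/twisted_conjP; exists z^-1%g.
by rewrite multiplicativeV -[X in (X * _)%g](mulKg z) -e -mulgA mulgK.
Qed.

Lemma twisted_conj_trans (x y z : G) :
  twisted_conj phi x y -> twisted_conj phi y z -> twisted_conj phi x z.
Proof.
move=> /twisted_conjP[u eu] /twisted_conjP[v ev]; apply/twisted_conjP.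
by exists (u * v)%g; rewrite gmulfM mulgA eu -mulgA ev mulgA.
Qed.

Lemma twisted_class_eqP (x y : G) :
  twisted_class phi x = twisted_class phi y <-> twisted_conj phi x y.
Proof.
split=> [e|xy].
  by have : twisted_class phi y x by rewrite -e; exact: twisted_conj_refl.
apply/seteqP; split=> u /= ux; first exact: twisted_conj_trans ux xy.
exact: twisted_conj_trans ux (twisted_conj_sym xy).
Qed.

Lemma reidemeister_number_card (T : finType) (f : T -> G) :
  (forall x, exists t, twisted_conj phi x (f t)) ->
  (forall t t', twisted_conj phi (f t) (f t') -> t = t') ->
  reidemeister_number phi = EFin #|T|.
Proof.
move=> cover irred.
have cE : twisted_classes phi = range (twisted_class phi \o f).
  apply/seteqP; split=> [_ [x _ <-]|_ [t _ <-]]; last by exists (f t).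
  by have [t xt] := cover x; exists t => //; apply/esym/twisted_class_eqP.
have finT : finite_set [set: T] by exact: finite_finset.
have fin : finite_set (twisted_classes phi).
  by rewrite cE; exact: finite_image.
rewrite /reidemeister_number asboolT //; congr EFin.
rewrite cE fset_set_image // card_imfset /=; last first.
  by move=> t t' /= /twisted_class_eqP/irred.
have -> : fset_set [set: T] = [fset t in predT]%fset.
  by apply/fsetP=> t; rewrite in_fset_set // !in_fset in_setT.
by rewrite card_imfset //= -cardE.
Qed.

Lemma reidemeister_number_infinite :
  ~ finite_set (twisted_classes phi) -> reidemeister_number phi = +oo%E.
Proof. by move=> inf; rewrite /reidemeister_number asboolF. Qed.

Lemma twisted_conj_collision (f : nat -> G) :
  finite_set (twisted_classes phi) ->
  exists i j, (i < j)%N /\ twisted_conj phi (f i) (f j).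
Proof.
move=> fin.
have [] := @finite_range_collision _ (twisted_class phi \o f).
  by apply: sub_finite_set fin => _ [i _ <-]; exists (f i).
by move=> i [j [ij /twisted_class_eqP]]; exists i, j.
Qed.

(** Saturating under [E] maps the finitely many twisted classes onto the [E]-classes. It serves for
    conjugacy in G/P, with [X] the elements of one exponent modulo 3. *)
Lemma coarser_representatives (E : G -> G -> Prop) (X : set G) :
  finite_set (twisted_classes phi) ->
  (forall x y, twisted_conj phi x y -> E x y) ->
  (forall x, E x x) -> (forall x y, E x y -> E y x) ->
  (forall x y z, E x y -> E y z -> E x z) ->
  exists (T : finType) (r : T -> G), [/\ forall t, X (r t),
    forall x, X x -> exists t, E x (r t) &
    forall t t', E (r t) (r t') -> t = t'].
Proof.
move=> fin tE Er Es Et.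
pose cl y := [set x | E x y].
have clP x y : cl x = cl y <-> E x y.
  split=> [e|xy]; first by have : cl y x by rewrite -e; exact: Er.
  by apply/seteqP; split=> u /= ux; [exact: Et ux xy|exact: Et ux (Es _ _ xy)].
have finW : finite_set (cl @` X).
  pose sat (S : set G) := [set x | exists2 y, S y & E x y].
  apply: (@sub_finite_set _ _ (sat @` twisted_classes phi));
    last exact: finite_image.
  move=> _ [x _ <-]; exists (twisted_class phi x); first by exists x.
  apply/seteqP; split=> u /=; last by move=> ux; exists x => //; exact: twisted_conj_refl.
  by move=> [y yx uy]; exact: Et uy (tE _ _ yx).
pose T := fset_set (cl @` X).
have rP (t : T) : {x | X x & cl x = val t}.
  by apply: cid2; have := valP t; rewrite in_fset_set // inE => -[x]; exists x.
exists T, (fun t => s2val (rP t)); split.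
- by move=> t; case: (rP t).
- move=> x Xx.
  have h : cl x \in T by rewrite in_fset_set // inE; exists x.
  by exists [` h]%fset; apply/clP; case: (rP _).
- move=> t t' /clP; case: (rP t) => x _ /= ->; case: (rP t') => x' _ /= ->.
  exact: val_inj.
Qed.

End TwistedConjugacy.

(** * The action of A on Z^3, heights, and the plane P *)

Definition col3 (x y z : int) : 'cV[int]_3 := \col_i nth 0 [:: x; y; z] i.

Lemma col3_surj (v : 'cV[int]_3) : exists x y z, v = col3 x y z.
Proof.
exists (v 0 0), (v 1 0), (v 2 0); apply/colP=> i; rewrite mxE.
by case: i => -[|[|[|//]]] i /=; congr (v _ _); apply: val_inj.
Qed.

Lemma col3_inj x y z x' y' z' :
  col3 x y z = col3 x' y' z' -> [/\ x = x', y = y' & z = z'].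
Proof.
by move=> /colP e; split; [have := e 0|have := e 1|have := e 2]; rewrite !mxE.
Qed.

Lemma col3D x y z x' y' z' :
  col3 x y z + col3 x' y' z' = col3 (x + x') (y + y') (z + z').
Proof. by apply/colP=> -[[|[|[|//]]] i]; rewrite !mxE. Qed.

Lemma col3Z c x y z : c *: col3 x y z = col3 (c * x) (c * y) (c * z).
Proof. by apply/colP=> -[[|[|[|//]]] i]; rewrite !mxE. Qed.

Section MatA.
Variable delta : int.
Local Notation A := (matA delta).

Lemma mulmx_matA x y z : A *m col3 x y z = col3 (x + delta * z) (- z) (y - z).
Proof.
apply/colP=> -[[|[|[|//]]] i]; rewrite !mxE !big_ord_recl big_ord0 !mxE /=; lia.
Qed.

(* A-invariant, with kernel P; its image is 3Z if delta = 0 and Z if delta = 1. *)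
Definition height (v : 'cV[int]_3) : int :=
  3 * v 0 0 + delta * (v 1 0 + v 2 0).

Lemma height_col3 x y z : height (col3 x y z) = 3 * x + delta * (y + z).
Proof. by rewrite /height !mxE. Qed.

Lemma heightD u v : height (u + v) = height u + height v.
Proof. by rewrite /height !mxE; ring. Qed.

Lemma heightN v : height (- v) = - height v.
Proof. by rewrite /height !mxE; ring. Qed.

Lemma heightB u v : height (u - v) = height u - height v.
Proof. by rewrite heightD heightN. Qed.

Lemma heightZ c v : height (c *: v) = c * height v.
Proof. by rewrite /height !mxE; ring. Qed.

Lemma height0 : height 0 = 0.
Proof. by rewrite /height !mxE; ring. Qed.

Lemma height_matA v : height (A *m v) = height v.
Proof.
have [x [y [z ->]]] := col3_surj v.
rewrite mulmx_matA !height_col3; ring.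
Qed.

Lemma matA_exp3 : A ^+ 3 = 1.
Proof.
suff h (v : 'cV[int]_3) : A *m (A *m (A *m v)) = v.
  apply/matrixP=> i j; rewrite exprSr expr2.
  have /colP/(_ i) := h (delta_mx j 0).
  by rewrite !mulmxA -colE [LHS]mxE => ->; rewrite !mxE eqxx andbT.
have [x [y [z ->]]] := col3_surj v.
by rewrite !mulmx_matA; congr col3; ring.
Qed.

Lemma mod3_cases (k : int) :
  [\/ (k = 0 %[mod 3])%Z, (k = 1 %[mod 3])%Z | (k = 2 %[mod 3])%Z].
Proof.
have [e|[e|e]] : ((k %% 3)%Z = 0 \/ (k %% 3)%Z = 1 \/ (k %% 3)%Z = 2) by lia.
- by constructor 1.
- by constructor 2.
- by constructor 3.
Qed.

Lemma matA_expz_mod k l : (k = l %[mod 3])%Z -> A ^ k = A ^ l.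
Proof.
move=> e; have -> : k = 3 * ((k - l) %/ 3)%Z + l by lia.
by rewrite exprzDr ?matA_unit // -exprz_exp -exprnP matA_exp3 exp1rz mul1r.
Qed.

Lemma mulmx_expzD k l (v : 'cV[int]_3) : A ^ (k + l) *m v = A ^ k *m (A ^ l *m v).
Proof. by rewrite exprzDr ?matA_unit // mulmxA. Qed.

Lemma mulmx_expz0 (v : 'cV[int]_3) : A ^ 0 *m v = v.
Proof. by rewrite expr0z mul1mx. Qed.

Lemma mulmx_expz1 (v : 'cV[int]_3) : A ^ 1 *m v = A *m v.
Proof. by rewrite expr1z. Qed.

Lemma mulmx_expzK k (v : 'cV[int]_3) : A ^ (- k) *m (A ^ k *m v) = v.
Proof. by rewrite -mulmx_expzD addNr mulmx_expz0. Qed.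

Lemma mulmx_expz2 (v : 'cV[int]_3) : A ^ 2 *m v = A *m (A *m v).
Proof. by rewrite -[2 : int]/(1 + 1) mulmx_expzD !mulmx_expz1. Qed.

Lemma height_expz k v : height (A ^ k *m v) = height v.
Proof.
have [e|e|e] := mod3_cases k.
- by rewrite (matA_expz_mod e) mulmx_expz0.
- by rewrite (matA_expz_mod e) mulmx_expz1 height_matA.
- by rewrite (matA_expz_mod e) mulmx_expz2 !height_matA.
Qed.

(** A fixed vector of A. Together with P it spans Z^3 if delta = 0, and a subgroup of index 3 if
    delta = 1. *)
Definition e1 : 'cV[int]_3 := col3 1 0 0.

Lemma height_e1 : height e1 = 3.
Proof. by rewrite height_col3; ring. Qed.

Lemma matA_e1 : A *m e1 = e1.
Proof. by rewrite mulmx_matA; congr col3; ring. Qed.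

Lemma expz_e1 k c : A ^ k *m (c *: e1) = c *: e1.
Proof.
have Ae : A *m (c *: e1) = c *: e1 by rewrite -scalemxAr matA_e1.
have [e|e|e] := mod3_cases k.
- by rewrite (matA_expz_mod e) mulmx_expz0.
- by rewrite (matA_expz_mod e) mulmx_expz1.
- by rewrite (matA_expz_mod e) mulmx_expz2 !Ae.
Qed.

Hypothesis hdelta : delta = 0 \/ delta = 1.

(** The vector (0, 1, 0) if delta = 0 and (0, -1, 1) if delta = 1; it and its image under A form a
    basis of P. *)
Definition plane_gen : 'cV[int]_3 := col3 0 (1 - 2 * delta) delta.

(* P = Z[w] with w acting as A and 1 as plane_gen: plane x y stands for x + y w. *)
Definition plane (x y : int) : 'cV[int]_3 := x *: plane_gen + y *: (A *m plane_gen).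

Lemma planeE x y :
  plane x y = col3 (delta * y) ((1 - 2 * delta) * x - delta * y)
                (delta * x + (1 - 3 * delta) * y).
Proof.
rewrite /plane /plane_gen mulmx_matA !col3Z col3D.
by case: hdelta => ->; congr col3; ring.
Qed.

Lemma plane_inj x y x' y' : plane x y = plane x' y' -> x = x' /\ y = y'.
Proof. by rewrite !planeE => /col3_inj[]; case: hdelta => ->; lia. Qed.

Lemma height_plane x y : height (plane x y) = 0.
Proof. by rewrite planeE height_col3; case: hdelta => ->; ring. Qed.

Lemma height_addplane v x y : height (v + plane x y) = height v.
Proof. by rewrite [LHS]heightD height_plane addr0. Qed.

Lemma height_eq0 v : height v = 0 -> exists x y, v = plane x y.
Proof.
have [x [y [z ->]]] := col3_surj v; rewrite height_col3.
case: hdelta => d h.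
  by exists y, z; rewrite planeE d; congr col3; lia.
by exists (- x - y), x; rewrite planeE d; congr col3; lia.
Qed.

Lemma planeD x y x' y' : plane x y + plane x' y' = plane (x + x') (y + y').
Proof. by rewrite /plane !scalerDl addrACA. Qed.

Lemma planeN x y : - plane x y = plane (- x) (- y).
Proof. by rewrite /plane !scaleNr opprD. Qed.

Lemma planeZ c x y : c *: plane x y = plane (c * x) (c * y).
Proof. by rewrite /plane scalerDr !scalerA. Qed.

Lemma plane0 : plane 0 0 = 0.
Proof. by rewrite /plane !scale0r addr0. Qed.

Lemma matA_plane x y : A *m plane x y = plane (- y) (x - y).
Proof. by rewrite !planeE mulmx_matA; case: hdelta => ->; congr col3; ring. Qed.

(** Multiplication by 1 - w or 1 - w^2 is injective on Z[w]. *)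
Lemma expz_plane_fixed k x y :
  A ^ k *m plane x y = plane x y -> (k = 0 %[mod 3])%Z \/ plane x y = 0.
Proof.
have [e|e|e] := mod3_cases k.
- by left.
- rewrite (matA_expz_mod e) mulmx_expz1 matA_plane => /plane_inj[a b]; right.
  have [-> ->] : x = 0 /\ y = 0 by lia.
  exact: plane0.
- rewrite (matA_expz_mod e) mulmx_expz2 !matA_plane => /plane_inj[a b]; right.
  have [-> ->] : x = 0 /\ y = 0 by lia.
  exact: plane0.
Qed.

End MatA.

(* Otherwise [rewrite] with additivity lemmas sees the sum inside [plane]. *)
Opaque plane.

(** * Six twisted classes for each coarse class of suitable exponent *)

Section Counting.
Variable delta : int.
Local Notation A := (matA delta).
Local Notation G := (sdprodZ (matA_unit delta)).
Local Notation ht := (height delta).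
Variable phi : {multiplicative G -> G}.

(* Twisted conjugacy in G/P, where an element is determined by (height, exponent). *)
Definition coarse_conj (x y : G) : Prop :=
  exists z : G, ht x.1 + ht (phi z).1 = ht z.1 + ht y.1 /\
                x.2 + (phi z).2 = z.2 + y.2.

Lemma twisted_conj_coarse x y : twisted_conj phi x y -> coarse_conj x y.
Proof.
move=> /twisted_conjP[z [e1 e2]]; exists z; split=> //.
by move/(congr1 ht): e1; rewrite !heightD !height_expz.
Qed.

Lemma coarse_conj_twisted x y : coarse_conj x y ->
  exists v, ht v = 0 /\ twisted_conj phi x (y.1 + v, y.2).
Proof.
move=> [z [h1 h2]].
(* Solve [x * phi z = z * (y.1 + v, y.2)] for [v]; the coarse equation for heights puts the solution
   in P. *)
exists (A ^ (- z.2) *m (x.1 + A ^ x.2 *m (phi z).1 - z.1) - y.1); split.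
  by rewrite heightB height_expz heightB heightD height_expz; lia.
apply/twisted_conjP; exists z.
congr pair => //=; rewrite addrCA subrr addr0.
by rewrite -mulmx_expzD subrr mulmx_expz0 addrCA subrr addr0.
Qed.

Lemma coarse_conj_refl x : coarse_conj x x.
Proof. exact/twisted_conj_coarse/twisted_conj_refl. Qed.

Lemma phi_inv (x : G) :
  ht (phi (x^-1)%g).1 = - ht (phi x).1 /\ (phi (x^-1)%g).2 = - (phi x).2.
Proof. by rewrite multiplicativeV /= heightN height_expz. Qed.

Lemma coarse_conj_sym x y : coarse_conj x y -> coarse_conj y x.
Proof.
move=> [z [h1 h2]]; exists (z^-1)%g; have [-> ->] := phi_inv z.
by rewrite heightN height_expz /=; lia.
Qed.

Lemma coarse_conj_trans x y z :
  coarse_conj x y -> coarse_conj y z -> coarse_conj x z.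
Proof.
move=> [u [h1 h2]] [v [k1 k2]]; exists (u * v)%g.
by rewrite gmulfM !heightD !height_expz /=; lia.
Qed.

Hypothesis hdelta : delta = 0 \/ delta = 1.
Variable i : int.
Hypothesis phi_plane : forall v, ht v = 0 -> phi (v, 0) = (- (A ^ i *m v), 0).
Hypothesis phi_mod3 : forall x, ((phi x).2 = x.2 %[mod 3])%Z.
Hypothesis phi_fix : forall z, ht (phi z).1 = ht z.1 -> (phi z).2 = z.2 ->
  ht z.1 = 0 /\ z.2 = 0.

(* The witness u in P gives u - A^k (- A^i u). *)
Lemma twisted_conj_translate (u v : 'cV[int]_3) (k : int) : ht u = 0 ->
  twisted_conj phi (v + (u + A ^ (k + i) *m u), k) (v, k).
Proof.
move=> hu; apply/twisted_conjP; exists (u, 0); rewrite phi_plane //.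
congr pair; last by rewrite /= addr0 add0r.
by rewrite /= mulmx_expz0 mulmx_expzD mulmxN addrA addrK addrC.
Qed.

(** Here 1 + A^(k+i) acts on P as 1 + w = -w^2 or 1 + w^2 = -w, a unit, so every translation by P is
    attained. The preimages below are products with the inverses -w and -w^2. *)
Lemma twisted_conj_translate_unit (v w : 'cV[int]_3) (k : int) :
  ~ (k + i = 0 %[mod 3])%Z -> ht w = 0 -> twisted_conj phi (v + w, k) (v, k).
Proof.
move=> ki /(height_eq0 hdelta)[x [y ->]].
have [e|e] : (k + i = 1 %[mod 3])%Z \/ (k + i = 2 %[mod 3])%Z by lia.
  have -> : plane delta x y = plane delta y (y - x) +
      A ^ (k + i) *m plane delta y (y - x).
    rewrite (matA_expz_mod _ e) mulmx_expz1 matA_plane // planeD.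
    by congr (plane _ _ _); ring.
  exact/twisted_conj_translate/height_plane.
have -> : plane delta x y = plane delta (x - y) x +
    A ^ (k + i) *m plane delta (x - y) x.
  rewrite (matA_expz_mod _ e) mulmx_expz2 !matA_plane // planeD.
  by congr (plane _ _ _); ring.
exact/twisted_conj_translate/height_plane.
Qed.

(** Here 1 + A^(k+i) is 2 on P, so the classes are those of P/2P. *)
Lemma twisted_conj_translate_double (v : 'cV[int]_3) (k x y x' y' : int) :
  (k + i = 0 %[mod 3])%Z ->
  twisted_conj phi (v + plane delta x y, k) (v + plane delta x' y', k) <->
  (x = x' %[mod 2])%Z /\ (y = y' %[mod 2])%Z.
Proof.
move=> ki; split.
  move=> /twisted_conjP[[u l] [e1 e2]].
  (* Both elements have the same image in G/P, so the image of the witness there is fixed by [phi],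
     hence trivial. *)
  have [/= h1 h2] : ht u = 0 /\ l = 0.
    move/(congr1 ht): (e1).
    rewrite /= [ht (_ + A ^ k *m _)]heightD [ht (u + _)]heightD.
    rewrite !height_expz !height_addplane // => h1.
    apply: (phi_fix (z := (u, l))).
      by apply: (addrI (ht v)); rewrite h1 addrC.
    by apply: (addrI k); rewrite e2 addrC.
  move: e1; rewrite h2 phi_plane //=; have [a [b ->]] := height_eq0 hdelta h1.
  rewrite mulmx_expz0 mulmxN -mulmx_expzD (matA_expz_mod _ ki).
  rewrite mulmx_expz0 -addrA [RHS]addrCA => /addrI.
  by rewrite planeN !planeD => /(plane_inj hdelta); lia.
move=> [ex ey].
pose u := plane delta ((x - x') %/ 2)%Z ((y - y') %/ 2)%Z.
have -> : v + plane delta x y = v + plane delta x' y' + (u + A ^ (k + i) *m u).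
  rewrite (matA_expz_mod _ ki) mulmx_expz0 -addrA !planeD.
  by congr (_ + plane _ _ _); lia.
exact/twisted_conj_translate/height_plane.
Qed.

Variables (T : finType) (r : T -> G).
Hypothesis r_mod3 : forall t, ((r t).2 + i = 0 %[mod 3])%Z.
Hypothesis r_cover : forall x : G,
  (x.2 + i = 0 %[mod 3])%Z -> exists t, coarse_conj x (r t).
Hypothesis r_inj : forall t t', coarse_conj (r t) (r t') -> t = t'.

(** [inl] lists the four classes of P/2P over exponent -i modulo 3; [inr] gives the single class
    over each of the exponents 1 - i and 2 - i. *)
Definition fine_representative (s : T * ((bool * bool) + bool)) : G :=
  match s.2 with
  | inl (b, c) => ((r s.1).1 + plane delta (b : nat) (c : nat), (r s.1).2)
  | inr b => ((r s.1).1, (r s.1).2 + if b then 2 else 1)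
  end.

Lemma fine_cover x : exists s, twisted_conj phi x (fine_representative s).
Proof.
(* G/P is abelian, so coarse conjugacy survives a common shift of exponents; this reduces all
   residues to the one covered by [r]. *)
have shift (m : int) : (x.2 + i = m %[mod 3])%Z -> exists t v,
    ht v = 0 /\ twisted_conj phi x ((r t).1 + v, (r t).2 + m).
  move=> xm; have [/=|t [z [h1 h2]]] := r_cover (x := (x.1, x.2 - m)); first by lia.
  exists t; have [|v [hv ?]] := @coarse_conj_twisted x ((r t).1, (r t).2 + m).
    by exists z; move: h1 h2 => /=; lia.
  by exists v.
have [e|e|e] := mod3_cases (x.2 + i).
- have [t [v [/(height_eq0 hdelta)[a [b ->]] xt]]] := shift _ e.
  exists (t, inl ((a %% 2)%Z == 1, (b %% 2)%Z == 1)).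
  apply: twisted_conj_trans xt _; rewrite addr0 /fine_representative /=.
  apply/twisted_conj_translate_double; first exact: r_mod3.
  by case: eqP; case: eqP => /=; lia.
- have [t [v [hv xt]]] := shift _ e; exists (t, inr false).
  apply: twisted_conj_trans xt _.
  by apply: twisted_conj_translate_unit => //; have := r_mod3 t; lia.
- have [t [v [hv xt]]] := shift _ e; exists (t, inr true).
  apply: twisted_conj_trans xt _.
  by apply: twisted_conj_translate_unit => //; have := r_mod3 t; lia.
Qed.

Lemma fine_inj s s' :
  twisted_conj phi (fine_representative s) (fine_representative s') -> s = s'.
Proof.
move=> ss'; have [z [h1 h2]] := twisted_conj_coarse ss'.
move: ss' h1 h2; case: s s' => [t s] [t' s'].
have := r_mod3 t; have := r_mod3 t'; have := phi_mod3 z.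
have rr : ht (r t).1 + ht (phi z).1 = ht z.1 + ht (r t').1 ->
  (r t).2 + (phi z).2 = z.2 + (r t').2 -> t = t'.
  by move=> *; apply: r_inj; exists z.
(* Coarsely conjugate elements have equal exponents modulo 3, which separates the three kinds of
   representatives. *)
case: s s' => [[b c]|b] [[b' c']|b'] /= z3 t3 t3' ss' h1 h2.
- move: h1; rewrite !height_addplane // => h1.
  have tt := rr h1 h2; rewrite -tt in ss' *.
  move/(twisted_conj_translate_double _ _ _ _ _ (r_mod3 t)): ss'.
  by case: (b) (b') (c) (c') => -[] [] [] [] //.
- by exfalso; case: b' h2 {ss'}; lia.
- by exfalso; case: b h2 {ss'}; lia.
- have bb : b = b' by case: b b' h2 {ss'} => -[]; lia.
  by rewrite bb in h2 *; rewrite rr //; lia.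
Qed.

Lemma reidemeister_number_coarse : reidemeister_number phi = EFin (6 * #|T|)%N.
Proof.
rewrite (reidemeister_number_card fine_cover fine_inj).
by rewrite card_prod card_sum card_prod !card_bool mulnC.
Qed.

End Counting.

(** * Integer linear algebra and norms in Z[w] *)

Lemma additive_intE (V : zmodType) (f : int -> V) :
  {morph f : x y / x + y} -> forall k, f k = f 1 *~ k.
Proof.
move=> fD; have f0 : f 0 = 0 by apply: (addrI (f 0)); rewrite -fD !addr0.
have fN k : f (- k) = - f k by apply: (addrI (f k)); rewrite -fD !subrr.
have fnat (n : nat) : f n = f 1 *+ n.
  by elim: n => [|n IH]; rewrite ?mulr0n // -addn1 PoszD fD IH mulrnDr.
by case=> n; rewrite ?NegzE ?fN fnat ?mulrNz.
Qed.

(** The matrix with rows (p, q) and (r, s) times the one with columns (a1, k1) and (a2, k2) is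
    diag(m, n). So ps - qr is nonzero, and Cramer's rule applies. *)
Lemma int_system_injective (p q r s a k a1 k1 a2 k2 m n : int) :
  p * a + q * k = 0 -> r * a + s * k = 0 ->
  p * a1 + q * k1 = m -> r * a1 + s * k1 = 0 ->
  p * a2 + q * k2 = 0 -> r * a2 + s * k2 = n ->
  m != 0 -> n != 0 -> a = 0 /\ k = 0.
Proof.
move=> e1 e2 e3 e4 e5 e6 m0 n0.
have d : (p * s - q * r) * (a1 * k2 - a2 * k1) = m * n.
  have -> : m * n = m * n - (r * a1 + s * k1) * (p * a2 + q * k2).
    by rewrite e4 mul0r subr0.
  by rewrite -e3 -e6; ring.
have d0 : p * s - q * r != 0.
  by apply: contra_neq (mulf_neq0 m0 n0) => d0; rewrite -d d0 mul0r.
split; apply: (mulfI d0); rewrite mulr0.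
  rewrite (_ : _ * a = s * (p * a + q * k) - q * (r * a + s * k)); last by ring.
  by rewrite e1 e2 !mulr0 subrr.
rewrite (_ : _ * k = p * (r * a + s * k) - r * (p * a + q * k)); last by ring.
by rewrite e1 e2 !mulr0 subrr.
Qed.

(** The form is the norm of x + y w. The first three solutions are 1, w, w^2, the last three their
    negatives. *)
Lemma eisenstein_norm1 (x y : int) : x ^+ 2 - x * y + y ^+ 2 = 1 ->
  [\/ (x, y) = (1, 0), (x, y) = (0, 1) | (x, y) = (-1, -1)] \/
  [\/ (x, y) = (-1, 0), (x, y) = (0, -1) | (x, y) = (1, 1)].
Proof.
move=> n1.
have hy : -1 <= y <= 1 by nia.
have hx : -1 <= x <= 1 by nia.
have [ey|[ey|ey]] : y = -1 \/ y = 0 \/ y = 1 by lia.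
all: have [ex|[ex|ex]] : x = -1 \/ x = 0 \/ x = 1 by lia.
all: move: n1; rewrite ex ey => // _; try by (left; constructor).
all: try by (right; constructor).
Qed.

Lemma eisenstein_norm_unit (x y a b : int) :
  (x ^+ 2 - x * y + y ^+ 2) * (a ^+ 2 - a * b + b ^+ 2) = 1 ->
  x ^+ 2 - x * y + y ^+ 2 = 1.
Proof.
move=> e; have : 0 <= x ^+ 2 - x * y + y ^+ 2 by nia.
have : 0 <= a ^+ 2 - a * b + b ^+ 2 by nia.
move: (x ^+ 2 - _ + _) (a ^+ 2 - _ + _) e => u v uv v0 u0.
have : u != 0 by apply: contra_eq_neq uv => ->; rewrite mul0r.
have : v != 0 by apply: contra_eq_neq uv => ->; rewrite mulr0.
nia.
Qed.

(** * Automorphisms with finite Reidemeister number *)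

Section Automorphism.
Variables (delta : int) (hdelta : delta = 0 \/ delta = 1).
Local Notation A := (matA delta).
Local Notation G := (sdprodZ (matA_unit delta)).
Local Notation ht := (height delta).

Local Notation el v k := ((v%R, k%R) : G).

(** P is torsion in the abelianization of G, and Z is torsion-free. Applied to the height and
    exponent of images, this makes P characteristic. *)
Lemma hom_int_plane (h : G -> int) (v : 'cV[int]_3) :
  (forall x y : G, h (x * y)%g = h x + h y) -> ht v = 0 -> h (v, 0) = 0.
Proof.
move=> hM /(height_eq0 hdelta)[x [y ->]].
(* 3v = (A - 1)w makes (v, 0)^3 a commutator of (0, 1) and (w, 0). *)
set v' := plane _ _ _; pose w := plane delta (y - 2 * x) (- x - y).
have e : (el v' 0 * (el v' 0 * (el v' 0 * (el w 0 * el 0 1))) = el 0 1 * el w 0)%g.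
  congr pair => //=.
  rewrite !mulmx_expz0 mulmx_expz1 add0r addr0 matA_plane // !planeD.
  by congr (plane _ _ _); ring.
by move/(congr1 h): e; rewrite !hM; lia.
Qed.

Lemma hom_int_level (h : G -> int) (k : int) :
  (forall x y : G, h (x * y)%g = h x + h y) -> h (0, k) = k * h (0, 1).
Proof.
move=> hM; rewrite (additive_intE (f := fun k => h (el 0 k))) => [|a b].
  by rewrite mulrzz mulrC.
by rewrite -hM; congr h; congr pair; rewrite /= mulmx0 addr0.
Qed.

(** Such a homomorphism factors through G/P. The factor 3 is the height of [e1]: the vector 3v -
    ht(v) e1 lies in P. *)
Lemma hom_intE (h : G -> int) (x : G) :
  (forall x y : G, h (x * y)%g = h x + h y) ->
  3 * h x = ht x.1 * h (e1, 0) + 3 * x.2 * h (0, 1).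
Proof.
move=> hM; case: x => v k /=.
have -> : h (v, k) = h (v, 0) + h (0, k).
  by rewrite -hM; congr h; congr pair; rewrite /= ?mulmx_expz0 ?addr0 ?add0r.
have hD u w : h (u + w, 0) = h (u, 0) + h (w, 0).
  by rewrite -hM; congr h; congr pair; rewrite /= mulmx_expz0.
have hZ c u : h (c *: u, 0) = c * h (u, 0).
  have := @additive_intE _ (fun c => h (el (c *: u) 0)).
  move=> /(_ _ c) ->; first by rewrite scale1r mulrzz mulrC.
  by move=> a b; rewrite scalerDl hD.
have : h (3 *: v + - (ht v) *: e1, 0) = 0.
  by apply: hom_int_plane => //; rewrite heightD !heightZ height_e1; ring.
rewrite hD !hZ mulNr => /subr0_eq e; rewrite mulrDr e (hom_int_level _ hM); ring.
Qed.

Variable phi : {multiplicative G -> G}.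

Lemma aut_heightM (x y : G) :
  ht (phi (x * y)%g).1 = ht (phi x).1 + ht (phi y).1.
Proof. by rewrite gmulfM heightD height_expz. Qed.

Lemma aut_levelM (x y : G) : (phi (x * y)%g).2 = (phi x).2 + (phi y).2.
Proof. by rewrite gmulfM. Qed.

Lemma aut_planeE (v : 'cV[int]_3) : ht v = 0 ->
  phi (v, 0) = ((phi (v, 0)).1, 0) /\ ht (phi (v, 0)).1 = 0.
Proof.
move=> hv; split; last exact: (hom_int_plane (h := fun x => ht (phi x).1) aut_heightM).
have := hom_int_plane (h := fun x => (phi x).2) aut_levelM hv.
by case: (phi _) => w k /= ->.
Qed.

Hypothesis phi_bij : bijective phi.

Lemma aut_plane_surj (v : 'cV[int]_3) : ht v = 0 ->
  exists2 u, ht u = 0 & phi (u, 0) = (v, 0).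
Proof.
case: phi_bij => psi phiK psiK hv.
have psiM : {morph psi : x y / (x * y)%g} := can2_gmulfM phiK psiK.
have h1 : ht (psi (v, 0)).1 = 0.
  apply: (hom_int_plane (h := fun x => ht (psi x).1)) => // x y.
  by rewrite psiM heightD height_expz.
have h2 : (psi (v, 0)).2 = 0.
  by apply: (hom_int_plane (h := fun x => (psi x).2)) => // x y; rewrite psiM.
exists (psi (v, 0)).1 => //.
by rewrite -[RHS]psiK; congr (phi _); move: h2; case: (psi _) => w k /= ->.
Qed.

Let restr (v : 'cV[int]_3) := (phi (v, 0)).1.

Lemma aut_restrE v : ht v = 0 -> phi (v, 0) = (restr v, 0).
Proof. by case/aut_planeE. Qed.

Lemma restr_height v : ht v = 0 -> ht (restr v) = 0.
Proof. by case/aut_planeE. Qed.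

Lemma restr_inj u v : ht u = 0 -> ht v = 0 -> restr u = restr v -> u = v.
Proof.
move=> hu hv e; have : phi (u, 0) = phi (v, 0) by rewrite !aut_restrE // e.
by move/(bij_inj phi_bij) => [].
Qed.

Lemma restr_surj v : ht v = 0 -> exists2 u, ht u = 0 & restr u = v.
Proof. by case/aut_plane_surj => u hu e; exists u => //; rewrite /restr e. Qed.

Lemma restr_planeE x y :
  restr (plane delta x y) = x *: restr (plane delta 1 0) + y *: restr (plane delta 0 1).
Proof.
have MD u v : ht u = 0 -> ht v = 0 -> restr (u + v) = restr u + restr v.
  move=> hu hv; rewrite /restr (_ : (u + v, 0) = (el u 0 * el v 0)%g); last first.
    by congr pair; rewrite /= mulmx_expz0.
  by rewrite gmulfM (aut_restrE hu) /= mulmx_expz0.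
have MZ c a b : restr (plane delta (c * a) (c * b)) = c *: restr (plane delta a b).
  have := @additive_intE _ (fun c => restr (plane delta (c * a) (c * b))).
  move=> /(_ _ c) ->; first by rewrite !mul1r -scaler_int intz.
  by move=> c' d; rewrite -MD ?height_plane // planeD !mulrDl.
have -> : plane delta x y = plane delta (x * 1) (x * 0) + plane delta (y * 0) (y * 1).
  by rewrite planeD !(mulr0, mulr1, addr0, add0r).
by rewrite MD ?height_plane // !MZ.
Qed.

(** Apply [phi] to the relation t v = (A v) t. Exponents 1 and 2 modulo 3 are the linear and
    semilinear cases on Z[w]. *)
Lemma restr_matA v : ht v = 0 -> restr (A *m v) = A ^ (phi (el 0 1)).2 *m restr v.
Proof.
move=> hv; have hAv : ht (A *m v) = 0 by rewrite height_matA.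
have e : (el 0 1 * el v 0 = el (A *m v) 0 * el 0 1)%g.
  by congr pair => //=; rewrite mulmx_expz0 mulmx_expz1 addr0 add0r.
have := congr1 phi e; rewrite !gmulfM !aut_restrE // => -[/= + _].
by rewrite mulmx_expz0 addrC => /addIr ->.
Qed.

Lemma aut_level_mod3 (x : G) :
  ((phi x).2 = x.2 * (phi (el 0 1)).2 %[mod 3])%Z.
Proof.
case: x => v k.
have vE : (v, k) = (el v 0 * el 0 k)%g.
  by congr pair; rewrite /= ?mulmx_expz0 ?addr0 ?add0r.
rewrite vE aut_levelM (hom_int_level (h := fun x => (phi x).2) _ aut_levelM) /= add0r.
(* As [v] commutes with P, its image commutes with phi(P) = P, which forces an exponent divisible by
   3. *)
suff e : ((phi (v, 0)).2 = 0 %[mod 3])%Z by rewrite -modzDml e mod0z add0r.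
have [u hu Mu] := restr_surj (height_plane hdelta 1 0).
have c : (el v 0 * el u 0 = el u 0 * el v 0)%g.
  by congr pair => //=; rewrite !mulmx_expz0 addrC.
have := congr1 phi c; rewrite !gmulfM (aut_restrE hu) => -[/= + _].
rewrite Mu mulmx_expz0 addrC => /addIr /(expz_plane_fixed hdelta)[|] //.
by rewrite -(plane0 delta) => /(plane_inj hdelta)[].
Qed.

Hypothesis phi_fin : finite_set (twisted_classes phi).

(** Collisions among the multiples of [e1] and among the powers of t put nonzero multiples of both
    in the image of 1 - D, so 1 - D is injective. *)
Lemma aut_fixed_plane (z : G) : ht (phi z).1 = ht z.1 -> (phi z).2 = z.2 ->
  ht z.1 = 0 /\ z.2 = 0.
Proof.
move=> z1 z2.
have [i [j [ij /twisted_conj_coarse[/= u [u1 u2]]]]] :=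
  twisted_conj_collision (fun n : nat => el (n%:Z *: e1) 0) phi_fin.
have [i' [j' [ij' /twisted_conj_coarse[/= w [w1 w2]]]]] :=
  twisted_conj_collision (fun n : nat => el 0 n%:Z) phi_fin.
have hE x := hom_intE (h := fun x => ht (phi x).1) x aut_heightM.
have kE x := hom_intE (h := fun x => (phi x).2) x aut_levelM.
move: (hE z) (hE u) (hE w) (kE z) (kE u) (kE w); rewrite /=.
move: u1 w1; rewrite !heightZ height_e1 height0.
set d11 := ht (phi (el e1 0)).1; set d12 := ht (phi (el 0 1)).1.
set d21 := (phi (el e1 0)).2; set d22 := (phi (el 0 1)).2.
move=> u1 w1 hz hu hw kz ku kw.
(* The matrix is 3(1 - D) in the coordinates height and exponent. *)
apply: (int_system_injective (p := 3 - d11) (q := - 3 * d12) (r := - d21)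
  (s := 3 - 3 * d22) (a1 := ht u.1) (k1 := u.2) (a2 := ht w.1) (k2 := w.2)
  (m := 9 * (i%:Z - j%:Z)) (n := 3 * (i'%:Z - j'%:Z))); lia.
Qed.

(** Two of the elements (n v) t^k are twisted conjugate; they agree in G/P, so the witness lies in
    P. Thus 1 - A^k phi has torsion cokernel on P. *)
Lemma aut_plane_torsion (k : int) (v : 'cV[int]_3) : ht v = 0 ->
  exists m x y, m != 0 /\
    plane delta x y - A ^ k *m restr (plane delta x y) = m *: v.
Proof.
move=> hv.
have [i [j [ij /twisted_conjP[[u l] [a b]]]]] :=
  twisted_conj_collision (fun n : nat => el (n%:Z *: v) k) phi_fin.
have [/= h1 h2] : ht u = 0 /\ l = 0.
  move/(congr1 ht): (a).
  rewrite /= !heightD !height_expz !heightZ hv !mulr0 add0r addr0 => h.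
  apply: (aut_fixed_plane (z := (u, l))) => //.
  by apply: (addrI k); rewrite b addrC.
have [x [y uE]] := height_eq0 hdelta h1.
exists (i%:Z - j%:Z), x, y; split; first by lia.
move: a; rewrite h2 /= mulmx_expz0 -/(restr u) -uE scalerBl => a.
by apply/eqP; rewrite subr_eq addrAC eq_sym subr_eq eq_sym a addrC.
Qed.

(** Otherwise [phi] would identify v and A v for v in P. *)
Lemma aut_level_not0 : ~ ((phi (el 0 1)).2 = 0 %[mod 3])%Z.
Proof.
move=> e; have := restr_matA (height_plane hdelta 1 0).
rewrite (matA_expz_mod _ e) mulmx_expz0 matA_plane //.
by move/restr_inj; rewrite !height_plane // => /(_ erefl erefl)/(plane_inj hdelta)[].
Qed.

(** In this case phi|P has trace 0 and determinant -N(u), so det(1 - phi|P) = 1 - N(u) = 0, against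
    the torsion cokernel. *)
Lemma aut_level_not2 : ~ ((phi (el 0 1)).2 = 2 %[mod 3])%Z.
Proof.
move=> e; have := restr_matA (height_plane hdelta 1 0).
rewrite (matA_expz_mod _ e) mulmx_expz2 matA_plane // oppr0 subr0.
have [x [y Mp]] := height_eq0 hdelta (restr_height (height_plane hdelta 1 0)).
rewrite Mp !matA_plane // => Mq.
have ME a b : restr (plane delta a b) =
    plane delta (a * x + b * (y - x)) (a * y - b * x).
  rewrite restr_planeE Mp Mq !planeZ planeD; congr (plane _ _ _); ring.
have [u /(height_eq0 hdelta)[a [b ->]]] := restr_surj (height_plane hdelta 1 0).
rewrite ME => /(plane_inj hdelta)[n1 n2].
(* A surjective semilinear map z |-> u * conj z has N(u) = 1. *)
have N1 : x ^+ 2 - x * y + y ^+ 2 = 1.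
  apply: (@eisenstein_norm_unit _ _ a b).
  transitivity ((a * x + b * (y - x)) ^+ 2 -
    (a * x + b * (y - x)) * (a * y - b * x) + (a * y - b * x) ^+ 2); first by ring.
  by rewrite n1 n2.
have [m [c [d [m0]]]] := aut_plane_torsion 0 (height_plane hdelta 1 0).
rewrite mulmx_expz0 ME planeN planeD planeZ mulr1 mulr0 => /(plane_inj hdelta)[m1 m2].
have [n [c' [d' [n0]]]] := aut_plane_torsion 0 (height_plane hdelta 0 1).
rewrite mulmx_expz0 ME planeN planeD planeZ mulr1 mulr0 => /(plane_inj hdelta)[m3 m4].
(* 1 - phi|P sends (c, d) to (m, 0) and (c', d') to (0, n), so mn is its determinant times cd' -
   dc'. *)
have /eqP[] := mulf_neq0 m0 n0.
transitivity ((1 - (x ^+ 2 - x * y + y ^+ 2)) * (c * d' - d * c')); last first.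
  by rewrite N1 subrr mul0r.
rewrite -[LHS]subr0 -[X in _ - X](mulr0 (d - (c * y - d * x))) -{1}m1 -{1}m4 -{1}m3.
ring.
Qed.

Lemma aut_level1 : ((phi (el 0 1)).2 = 1 %[mod 3])%Z.
Proof. by move: aut_level_not0 aut_level_not2; lia. Qed.

Lemma aut_plane_cases : exists i : int,
  forall v, ht v = 0 -> phi (v, 0) = (- (A ^ i *m v), 0).
Proof.
have [x [y Mp]] := height_eq0 hdelta (restr_height (height_plane hdelta 1 0)).
have := restr_matA (height_plane hdelta 1 0).
rewrite (matA_expz_mod _ aut_level1) mulmx_expz1 Mp !matA_plane // oppr0 subr0 => Mq.
have ME a b : restr (plane delta a b) =
    plane delta (a * x - b * y) (a * y + b * (x - y)).
  rewrite restr_planeE Mp Mq !planeZ planeD; congr (plane _ _ _); ring.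
have [u /(height_eq0 hdelta)[a [b ->]]] := restr_surj (height_plane hdelta 1 0).
rewrite ME => /(plane_inj hdelta)[n1 n2].
have N1 : x ^+ 2 - x * y + y ^+ 2 = 1.
  apply: (@eisenstein_norm_unit _ _ a b).
  transitivity ((a * x - b * y) ^+ 2 -
    (a * x - b * y) * (a * y + b * (x - y)) + (a * y + b * (x - y)) ^+ 2);
    first by ring.
  by rewrite n1 n2.
(* If phi|P were A^i, then 1 - A^(-i) phi would vanish on P, against the torsion cokernel. *)
have noroot i : (forall v, ht v = 0 -> restr v = A ^ i *m v) -> False.
  move=> Mi; have [m [c [d [m0]]]] := aut_plane_torsion (- i) (height_plane hdelta 1 0).
  rewrite Mi ?height_plane // mulmx_expzK subrr planeZ -(plane0 delta).
  by move=> /(plane_inj hdelta)[]; lia.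
have [] := eisenstein_norm1 N1.
- case=> -[ex ey]; exfalso; [apply: (noroot 0)|apply: (noroot 1)|apply: (noroot 2)]
    => v /(height_eq0 hdelta)[c [d ->]];
    rewrite ME ex ey.
  + by rewrite mulmx_expz0; congr (plane _ _ _); ring.
  + by rewrite mulmx_expz1 matA_plane //; congr (plane _ _ _); ring.
  + by rewrite mulmx_expz2 !matA_plane //; congr (plane _ _ _); ring.
- case=> -[ex ey]; [exists 0|exists 1|exists 2] => v hv;
    rewrite (aut_restrE hv); congr pair;
    have [c [d ->]] := height_eq0 hdelta hv; rewrite ME ex ey.
  + by rewrite mulmx_expz0 planeN; congr (plane _ _ _); ring.
  + by rewrite mulmx_expz1 matA_plane // planeN; congr (plane _ _ _); ring.
  + by rewrite mulmx_expz2 !matA_plane // planeN; congr (plane _ _ _); ring.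
Qed.

Lemma reidemeister_number_finite :
  exists n, (0 < n)%N /\ reidemeister_number phi = EFin (6 * n)%N.
Proof.
have mod3 x : ((phi x).2 = x.2 %[mod 3])%Z.
  by rewrite aut_level_mod3 -modzMmr aut_level1 modzMmr mulr1.
have [i phiP] := aut_plane_cases.
have [T [r [rX rC rI]]] := coarser_representatives
  [set x : G | (x.2 + i = 0 %[mod 3])%Z] phi_fin (@twisted_conj_coarse delta phi)
  (@coarse_conj_refl delta phi) (@coarse_conj_sym delta phi)
  (@coarse_conj_trans delta phi).
exists #|T|; split; last first.
  exact: (reidemeister_number_coarse hdelta phiP mod3 aut_fixed_plane rX rC rI).
(* The element t^(-i) shows that some coarse class has exponent -i modulo 3. *)
have [|t _] := rC (el 0 (- i)); first by rewrite /= addNr.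
by apply/card_gt0P; exists t.
Qed.

End Automorphism.

(** * An automorphism with Reidemeister number 6n *)

Section Realization.
Variables (delta : int) (n : nat).
Local Notation G := (sdprodZ (matA_unit delta)).
Local Notation ht := (height delta).
Local Notation m := (n%:Z).

(* -1 on P; D is chosen with det D = -1 and det(1 - D) = -3n for both values of
   delta, so that the exponent modulo 3n classifies the coarse classes. *)
Definition family_aut (x : G) : G :=
  (- x.1 + (2 * m * ht x.1 + x.2) *: e1,
   (3 * m - 6 * m ^+ 2) * ht x.1 + (1 - 3 * m) * x.2).

Definition family_inv (x : G) : G :=
  (- x.1 + (m * ht x.1 + x.2) *: e1,
   (3 * m - 6 * m ^+ 2) * ht x.1 + (1 - 6 * m) * x.2).

Lemma height_family_aut x :
  ht (family_aut x).1 = (6 * m - 1) * ht x.1 + 3 * x.2.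
Proof. by rewrite heightD heightN heightZ height_e1; ring. Qed.

Lemma height_family_inv x :
  ht (family_inv x).1 = (3 * m - 1) * ht x.1 + 3 * x.2.
Proof. by rewrite heightD heightN heightZ height_e1; ring. Qed.

Lemma family_aut_mod3 x : ((family_aut x).2 = x.2 %[mod 3])%Z.
Proof.
have -> : (family_aut x).2 = x.2 + ((m - 2 * m ^+ 2) * ht x.1 - m * x.2) * 3.
  by rewrite /=; ring.
by rewrite addrC modzMDl.
Qed.

(** Since exponents are preserved modulo 3, [x] and its image act on Z^3 by the same power of A,
    which fixes [e1] and preserves heights. *)
Lemma family_autM : {morph family_aut : x y / (x * y)%g}.
Proof.
move=> x y; have e := matA_expz_mod delta (family_aut_mod3 x).
congr pair.
  rewrite [in RHS]e mulmxDr mulmxN expz_e1 /= heightD height_expz opprD.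
  rewrite [RHS]addrACA -scalerDl; congr (_ + _ *: _); ring.
by rewrite /= heightD height_expz; ring.
Qed.

HB.instance Definition _ := isMultiplicative.Build G G family_aut family_autM.

Lemma family_autK : cancel family_aut family_inv.
Proof.
case=> v k; congr pair; rewrite height_family_aut /=; last by ring.
rewrite opprD opprK -addrA -scaleNr -scalerDl -[RHS]addr0.
by congr (_ + _); rewrite [X in X *: _](_ : _ = 0) ?scale0r //; ring.
Qed.

Lemma family_invK : cancel family_inv family_aut.
Proof.
case=> v k; congr pair; rewrite height_family_inv /=; last by ring.
rewrite opprD opprK -addrA -scaleNr -scalerDl -[RHS]addr0.
by congr (_ + _); rewrite [X in X *: _](_ : _ = 0) ?scale0r //; ring.
Qed.

Hypothesis n_gt0 : (0 < n)%N.
Hypothesis hdelta : delta = 0 \/ delta = 1.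

Lemma reidemeister_number_family :
  reidemeister_number (family_aut : {multiplicative G -> G}) = EFin (6 * n)%N.
Proof.
rewrite -[n in RHS]card_ord.
apply: (@reidemeister_number_coarse _ _ hdelta 0 _ _ _ 'I_n
  (fun j => (0, 3 * (j : nat)%:Z) : G)).
- move=> v hv; rewrite -[LHS]/(family_aut (v, 0)) /family_aut /=.
  rewrite hv mulmx_expz0 !mulr0 addr0.
  by rewrite scale0r addr0.
- exact: family_aut_mod3.
- move=> z; rewrite height_family_aut /=.
  move: (ht z.1) z.2 => H k a b.
  (* This is the exponent equation divided by 3. Cancelling [m] and substituting [k] in the height
     equation leaves H = 0. *)
  have /eqP : m * (k - (1 - 2 * m) * H) = 0 by lia.
  by rewrite mulf_eq0 subr_eq0 => /orP[/eqP|/eqP] ?; [lia|nia].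
- by move=> t /=; lia.
- case=> v k /=; rewrite addr0 => k3.
  (* Write k = 3(sn + j). A witness of height a and exponent s + (1 - 2n)a has its exponent lowered
     by 3ns under D; the height equation then forces a. *)
  pose s := ((k %/ 3)%Z %/ m)%Z; pose a := - ht v - 3 * s.
  have m0 : m != 0 by lia.
  have jge0 := modz_ge0 (k %/ 3)%Z m0.
  have jn : (`|((k %/ 3)%Z %% m)%Z|%N < n)%N.
    by rewrite -ltz_nat gez0_abs // ltz_pmod; lia.
  exists (Ordinal jn).
  exists (- v - s *: e1, s + (1 - 2 * m) * a).
  rewrite height_family_aut /= heightB heightN heightZ height_e1 height0; split.
    by rewrite /a; ring.
  rewrite /= gez0_abs //.
  have kE : k = 3 * (s * m + ((k %/ 3)%Z %% m)%Z) by rewrite -divz_eq; lia.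
  by rewrite {1}kE /a; ring.
- move=> j j' [z] /=; rewrite height0 height_family_aut /= => -[h1 h2].
  have d : (j : nat)%:Z = (j' : nat)%:Z + (z.2 - (1 - 2 * m) * ht z.1) * m by lia.
  apply/val_inj/eqP => /=; rewrite -eqz_nat.
  have lt_m (l : 'I_n) : (l%:Z %% m)%Z = l by rewrite modz_nat modn_small.
  by rewrite -[X in _ == X]lt_m -[X in X == _]lt_m d addrC modzMDl.
Qed.

End Realization.

(** * The value infinity and the whole spectrum *)

(** Ordinary conjugation preserves the exponent, so the powers of t lie in distinct classes. *)
Lemma reidemeister_number_idfun (delta : int) :
  reidemeister_number (idfun : {multiplicative sdprodZ (matA_unit delta) ->
    sdprodZ (matA_unit delta)}) = +oo%E.
Proof.
apply: reidemeister_number_infinite => fin.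
have [i [j [ij /twisted_conj_coarse[z [_ /=]]]]] :=
  twisted_conj_collision (fun n : nat => (0, n%:Z) : sdprodZ (matA_unit delta)) fin.
lia.
Qed.

Theorem proposition5p12 (delta : int) (hdelta : delta = 0 \/ delta = 1) :
  reidemeister_spectrum (sdprodZ (matA_unit delta)) =
    [set EFin (6 * n)%N | n in [set n : nat | (0 < n)%N]] `|` [set +oo%E].
Proof.
apply/seteqP; split=> [_ [phi /= phi_bij <-]|_ [[n /= n_gt0 <-]|->]].
- have [fin|inf] := pselect (finite_set (twisted_classes phi)).
    have [n [n_gt0 ->]] := reidemeister_number_finite hdelta phi_bij fin.
    by left; exists n.
  by right; exact: reidemeister_number_infinite.
- exists (family_aut n : {multiplicative _ -> _}).
    by exists (@family_inv delta n); [exact: family_autK|exact: family_invK].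
  exact: reidemeister_number_family.
- exists (idfun : {multiplicative _ -> _}); first by exists idfun.
  exact: reidemeister_number_idfun.
Qed.
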